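(* Let $G$ be a connected graph with $n\ge2$ vertices and $m$ edges, and assume $\gamma_n=0$ (i.e. $\frac{2m}{n}$ is a $Q$-eigenvalue of $G$). Then $$QE(G)\ \ge\ \frac{2m+M_1-\frac{4m^2}{n}}{\gamma_1},$$ with equality if and only if $G\cong K_{\frac n2,\frac n2}$.
   Context: All graphs are finite, simple and undirected. For a graph $G$ with $n$ vertices and $m$ edges, let $q_1\ge\cdots\ge q_n\ge0$ be the eigenvalues of the signless Laplacian $Q(G)=D(G)+A(G)$ ($D(G)$ the diagonal degree matrix, $A(G)$ the adjacency matrix). The signless Laplacian energy is $QE(G)=\sum_{i=1}^n|q_i-\frac{2m}{n}|$. $M_1=\sum_{v}d(v)^2$ is the first Zagreb index. Let $\gamma_1\ge\gamma_2\ge\cdots\ge\gamma_n\ge0$ denote the numbers $|q_i-\frac{2m}{n}|$, $i=1,\dots,n$, arranged in nonincreasing order. *)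

(* Defs.v *)
From mathcomp Require Import all_boot all_order all_algebra.
Set Implicit Arguments. Unset Strict Implicit. Unset Printing Implicit Defensive.
Import Order.TTheory GRing.Theory Num.Theory.
Local Open Scope ring_scope.

Definition simple_graph (n : nat) (e : rel 'I_n) : Prop :=
  symmetric e /\ irreflexive e.

Definition connected_graph (n : nat) (e : rel 'I_n) : Prop :=
  forall x y : 'I_n, connect e x y.

Definition deg (n : nat) (e : rel 'I_n) (v : 'I_n) : nat := #|[set w | e v w]|.

Definition edge_set (n : nat) (e : rel 'I_n) : {set {set 'I_n}} :=
  [set [set p.1; p.2] | p in [set p : 'I_n * 'I_n | e p.1 p.2]].

Definition nedges (n : nat) (e : rel 'I_n) : nat := #|edge_set e|.

Definition zagreb1 (n : nat) (e : rel 'I_n) : nat := (\sum_(v < n) (deg e v) ^ 2)%N.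

Definition signless_laplacian (R : nzRingType) (n : nat) (e : rel 'I_n) : 'M[R]_n :=
  \matrix_(i, j) (((i == j) * deg e i + e i j)%N)%:R.

Definition is_Q_spectrum (R : fieldType) (n : nat) (e : rel 'I_n) (s : seq R) : Prop :=
  char_poly (signless_laplacian R e) = \prod_(q <- s) ('X - q%:P).

Definition avg_deg (R : fieldType) (n : nat) (e : rel 'I_n) : R :=
  (2 * nedges e)%:R / n%:R.

Definition QE (R : numFieldType) (n : nat) (e : rel 'I_n) (s : seq R) : R :=
  \sum_(q <- s) `|q - avg_deg R e|.

Definition gamma1 (R : realFieldType) (n : nat) (e : rel 'I_n) (s : seq R) : R :=
  \big[Num.max/0]_(q <- s) `|q - avg_deg R e|.

(* complete bipartite graph K_{n/2,n/2} on 'I_n (n even): parts {i < n/2}, {i >= n/2} *)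
Definition Kbal (n : nat) : rel 'I_n :=
  fun i j => (i < n./2)%N != (j < n./2)%N.

Definition graph_iso (n : nat) (e1 e2 : rel 'I_n) : Prop :=
  exists f : 'I_n -> 'I_n, bijective f /\ forall x y, e1 x y = e2 (f x) (f y).

Definition is_K_half_half (n : nat) (e : rel 'I_n) : Prop :=
  ~~ odd n /\ graph_iso e (@Kbal n).

(* Main.v *)
Require Import Defs.
From mathcomp Require Import all_boot all_order all_algebra.
From mathcomp Require Import ring lra.
Set Implicit Arguments. Unset Strict Implicit. Unset Printing Implicit Defensive.
Import Order.TTheory GRing.Theory Num.Theory.
Local Open Scope ring_scope.

(** Write [a = 2m/n] and [B = Q - a]. Since [\tr B^2 = 2m + M_1 - 4m^2/n] is the sum of the squares
    of the [gamma_i], the inequality is [gamma_i^2 <= gamma_1 gamma_i], with equality exactly when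
    every [gamma_i] is [0] or [g = gamma_1]. In that case the symmetric matrix [B] satisfies
    [B^3 = g^2 B], because its characteristic polynomial divides a power of [X^3 - g^2 X] and a
    nilpotent symmetric matrix vanishes. This forces [g = a] and [G] regular of degree [d = a], so
    that [B] is the adjacency matrix. Then
    [B^3 = d^2 B] says that for each edge [uv] every neighbour of [u] is adjacent to every
    neighbour of [v], which for a connected regular graph means [K_{d,d}]. *)

(** * Traces of a matrix and of its square read off the spectrum *)

Lemma size_spectrum (R : comNzRingType) (n : nat) (A : 'M[R]_n) (s : seq R) :
  char_poly A = \prod_(q <- s) ('X - q%:P) -> size s = n.
Proof.
by move/(congr1 (fun p : {poly R} => size p)); rewrite size_char_poly size_prod_XsubC => -[].
Qed.

Lemma mxtrace_spectrum (R : comNzRingType) (n : nat) (A : 'M[R]_n) (s : seq R) :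
  char_poly A = \prod_(q <- s) ('X - q%:P) -> \tr A = \sum_(q <- s) q.
Proof.
move=> sA; have sz := size_spectrum sA.
case: n A sA sz => [|n] A sA sz.
  by move/size0nil: sz => ->; rewrite big_nil /mxtrace big_ord0.
apply: oppr_inj; rewrite -(@char_poly_trace _ _ A) // sA.
by rewrite -(coefPn_prod_XsubC) sz.
Qed.

(* [det (X^2 - A^2) = det (X - A) det (X + A)], and substituting [X^2]
    for [X] is injective on polynomials *)
Lemma char_poly_sqr (R : comNzRingType) (n : nat) (A : 'M[R]_n) (s : seq R) :
  char_poly A = \prod_(q <- s) ('X - q%:P) ->
  char_poly (A *m A) = \prod_(q <- [seq q ^+ 2 | q <- s]) ('X - q%:P).
Proof.
move=> sA; have sz := size_spectrum sA.
have comp2_inj (p r : {poly R}) : p \Po 'X^2 = r \Po 'X^2 -> p = r.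
  move=> e; apply/polyP=> i; have := congr1 (fun p : {poly R} => p`_(i * 2)) e.
  by rewrite /= !coef_comp_poly_Xn // dvdn_mull // mulnK.
apply: comp2_inj.
have detN : \det ('X%:M + map_mx polyC A) = (-1) ^+ n * (char_poly A \Po (- 'X)).
  rewrite /char_poly -(det_map_mx (comp_poly (- 'X))) -detZ; congr (\det _).
  apply/matrixP=> i j; rewrite !mxE /= comp_polyB comp_polyC.
  by case: (i == j); rewrite ?mulr1n ?mulr0n ?comp_polyX ?comp_poly0; ring.
have -> : char_poly (A *m A) \Po 'X^2 = char_poly A * \det ('X%:M + map_mx polyC A).
  rewrite /char_poly -det_mulmx -(det_map_mx (comp_poly 'X^2)); congr (\det _).
  rewrite /char_poly_mx mulmxDr !mulmxBl map_mxM.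
  rewrite [map_mx polyC A *m 'X%:M]scalar_mxC -[_ - _ + _]addrA addKr -scalar_mxM.
  have mapC (M : 'M[R]_n) : map_mx (comp_poly 'X^2) (map_mx polyC M) = map_mx polyC M.
    by apply/matrixP=> i j; rewrite !mxE /= comp_polyC.
  rewrite map_mxB map_mxM /= !mapC; congr (_ - _).
  apply/matrixP=> i j; rewrite !mxE /=.
  by case: (i == j); rewrite ?mulr1n ?mulr0n ?comp_polyX ?comp_poly0 // expr2.
rewrite detN sA -sz !rmorph_prod /= big_map mulrCA.
(* The sign [(-1) ^+ n] is shared out as one [-1] per root, so that each root contributes
   [('X - q) * ('X + q)]. *)
elim: {sA sz} s => [|q s IH]; first by rewrite !big_nil /= !mulr1.
rewrite !big_cons /= -IH exprS !comp_polyB !comp_polyX !comp_polyC rmorphXn /=.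
ring.
Qed.

Lemma mxtrace_sqr_spectrum (R : comNzRingType) (n : nat) (A : 'M[R]_n) (s : seq R) :
  char_poly A = \prod_(q <- s) ('X - q%:P) -> \tr (A *m A) = \sum_(q <- s) q ^+ 2.
Proof. by move/char_poly_sqr/mxtrace_spectrum->; rewrite big_map. Qed.

(** * Symmetric matrices over ordered rings *)

Lemma dot_ge0 (R : realDomainType) (n : nat) (x : 'rV[R]_n) : 0 <= (x *m x^T) 0 0.
Proof. by rewrite mxE sumr_ge0 // => i _; rewrite mxE -expr2 sqr_ge0. Qed.

Lemma dot_eq0 (R : realDomainType) (n : nat) (x : 'rV[R]_n) :
  (x *m x^T) 0 0 = 0 -> x = 0.
Proof.
rewrite mxE => x0; apply/rowP=> i; rewrite [RHS]mxE.
have xx_ge0 (j : 'I_n) : true -> 0 <= x 0 j * x^T j 0 by rewrite mxE -expr2 sqr_ge0.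
by have /eqP := psumr_eq0P xx_ge0 x0 (i := i) isT; rewrite mxE -expr2 sqrf_eq0 => /eqP.
Qed.

(** The diagonal of [M ^+ 2] for symmetric [M] consists of squared row norms, so [M ^+ 2 = 0] forces
    [M = 0]. Raising the exponent to [2 ^ k] lets it be halved down to 1. *)
Lemma symmetric_nilpotent_eq0 (R : realDomainType) (n : nat) (N : 'M[R]_n.+1) (k : nat) :
  N^T = N -> N ^+ k = 0 -> N = 0.
Proof.
move=> symN Nk0.
have sqr0 (M : 'M[R]_n.+1) : M^T = M -> M ^+ 2 = 0 -> M = 0.
  move=> symM M20; apply/row_matrixP=> i; rewrite row0; apply: dot_eq0.
  transitivity ((M ^+ 2) i i); last by rewrite M20 mxE.
  rewrite expr2 -mulmxE !mxE; apply: eq_bigr => j _.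
  by rewrite !mxE -[in RHS]symM [M^T j i]mxE symM.
have : N ^+ (2 ^ k) = 0.
  by rewrite -(subnK (ltnW (ltn_expl k (leqnn 2)))) exprD Nk0 mulr0.
elim: k {Nk0} => [|k IH]; first by rewrite expr1.
rewrite expnS mulnC exprM => /sqr0 h; apply: IH; apply: h.
elim: (2 ^ k)%N => [|m IH]; first by rewrite expr0 trmx1.
by rewrite [in LHS]exprS trmx_mul IH symN exprSr.
Qed.

(** Replaces diagonalisation: by Cayley-Hamilton the symmetric matrix [p(A)] is nilpotent, hence
    zero. *)
Lemma spectrum_annihilator (R : realFieldType) (n : nat) (A : 'M[R]_n.+1) (s : seq R)
    (p : {poly R}) :
  A^T = A -> char_poly A = \prod_(q <- s) ('X - q%:P) ->
  {in s, forall q, root p q} -> horner_mx A p = 0.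
Proof.
move=> symA sA rp.
have symp (r : {poly R}) : (horner_mx A r)^T = horner_mx A r.
  elim/poly_ind: r => [|r c IH]; first by rewrite rmorph0 trmx0.
  rewrite rmorphD rmorphM /= horner_mx_X horner_mx_C linearD /= tr_scalar_mx.
  by rewrite trmx_mul IH symA (comm_mx_horner r (comm_mx_refl A)).
apply: (@symmetric_nilpotent_eq0 _ _ _ (size s)) => //.
(* Each entry of [s] gets its own factor [p], which takes care of repeated eigenvalues. *)
have : \prod_(q <- s) ('X - q%:P) %| p ^+ size s.
  elim: {sA} s rp => [|q s IH] rp; first by rewrite big_nil dvd1p.
  rewrite big_cons exprS dvdp_mul ?dvdp_XsubCl ?rp ?mem_head //.
  by apply: IH => r rs; rewrite rp // inE rs orbT.
case/dvdpP=> r Er; rewrite -rmorphXn Er rmorphM /= -sA Cayley_Hamilton.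
by rewrite mulr0.
Qed.

(* [x (g^2 - B^2)] lies in the kernel of [B], and its squared norm is [g^2] times
   the difference of the two sides. *)
Lemma symmetric_norm_bound (R : realFieldType) (n : nat) (B : 'M[R]_n) (g : R) (x : 'rV[R]_n) :
  B^T = B -> 0 < g -> B *m B *m B = g ^+ 2 *: B ->
  ((x *m B) *m (x *m B)^T) 0 0 <= g ^+ 2 * (x *m x^T) 0 0.
Proof.
move=> symB g0 B3.
pose z := g ^+ 2 *: x - x *m (B *m B).
have zB : z *m B = 0 by rewrite mulmxBl -scalemxAl -mulmxA B3 -scalemxAr subrr.
have zz : z *m z^T = g ^+ 2 *: (g ^+ 2 *: (x *m x^T) - x *m B *m (x *m B)^T).
  rewrite {2}/z linearB linearZ /= mulmxBr !trmx_mul symB mulmxA mulmxA zB !mul0mx subr0.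
  by rewrite -scalemxAr /z mulmxBl -scalemxAl !mulmxA.
have := dot_ge0 z; rewrite zz.
rewrite mxE pmulr_rge0 ?exprn_gt0 // mxE [X in X + _]mxE [X in _ + X]mxE.
by rewrite subr_ge0.
Qed.

(** * Edge counting and recognition of balanced complete bipartite graphs *)

(** Both sides count ordered adjacent pairs: without loops, the map from pairs onto [edge_set] is
    two-to-one. *)
Lemma sum_deg (n : nat) (e : rel 'I_n) :
  simple_graph e -> (\sum_(v < n) deg e v = 2 * nedges e)%N.
Proof.
move=> [sym irr].
pose A := [set p : 'I_n * 'I_n | e p.1 p.2].
have -> : (\sum_(v < n) deg e v = \sum_(p in A) 1)%N.
  rewrite (eq_bigl (fun p => true && e p.1 p.2)) => [|p]; last by rewrite inE.
  rewrite -(pair_big_dep xpredT e (fun _ _ => 1%N)) /=.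
  by apply: eq_bigr => v _; rewrite sum1dep_card.
rewrite (partition_big_imset (fun p : 'I_n * 'I_n => [set p.1; p.2])) /=.
rewrite (eq_bigr (fun=> 2%N)) ?sum_nat_const ?(mulnC _ 2%N) //
  => _ /imsetP[[i j] /[!inE] /= eij ->].
have nij : i != j by apply: contraTneq eij => ->; rewrite irr.
rewrite sum1dep_card; transitivity #|[set (i, j); (j, i)]|; last first.
  by rewrite cards2 xpair_eqE (eq_sym j i) (negbTE nij).
apply: eq_card => -[k l]; rewrite !inE /= !xpair_eqE.
apply/andP/orP => [[ekl /eqP/setP h]|[] /andP[/eqP-> /eqP->]]; last 2 first.
- by rewrite eij.
- by rewrite sym eij setUC.
have kij : (k == i) || (k == j) by have := h k; rewrite !inE eqxx => <-.
have lij : (l == i) || (l == j) by have := h l; rewrite !inE eqxx orbT => <-.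
move: ekl kij lij => /[swap] /orP[] /eqP-> /[swap] /orP[] /eqP->;
  by rewrite ?irr // !eqxx; auto.
Qed.

(** Serves to relabel one side of a bipartition as the initial segment used by [Kbal]; the new label
    is the position in a list of [A] followed by its complement. *)
Lemma exists_bij_initial (n : nat) (A : {set 'I_n}) :
  exists2 f : 'I_n -> 'I_n, bijective f & forall x, (f x < #|A|)%N = (x \in A).
Proof.
pose l := enum A ++ enum (~: A).
have memA x : x \in l by rewrite mem_cat !mem_enum inE orbN.
have szl : size l = n by rewrite size_cat -!cardE cardsC card_ord.
have idx x : (index x l < n)%N by rewrite -[ltnRHS]szl index_mem.
exists (fun x => Ordinal (idx x)).
  apply: injF_bij => x y /(congr1 val) /= h.
  by rewrite -(nth_index x (memA x)) h nth_index.
move=> x /=; rewrite index_cat mem_enum cardE.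
case: ifP => xA; first by rewrite index_mem mem_enum.
by rewrite ltnNge leq_addr.
Qed.

(** Regularity turns inclusions of neighbourhoods into equalities: neighbours of [u] all have
    neighbourhood [N v], neighbours of [v] all have [N u]. Hence [N u] and [N v] are the two
    sides. *)
Lemma is_K_half_half_of_complete_nbhd (n : nat) (e : rel 'I_n) (d : nat) (u v : 'I_n) :
  simple_graph e -> connected_graph e -> (forall x, deg e x = d) -> e u v ->
  (forall w z, e u w -> e z v -> e w z) -> is_K_half_half e.
Proof.
move=> [sym irr] con reg euv full.
pose N x := [set y | e x y].
have cN x : #|N x| = d by exact: reg.
have Nu w : e u w -> N w = N v.
  move=> euw; apply/esym/eqP; rewrite eqEcard !cN leqnn andbT.
  by apply/subsetP=> z /[!inE] evz; apply: full => //; rewrite sym.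
have Nv z : e v z -> N z = N u.
  move=> evz; apply/esym/eqP; rewrite eqEcard !cN leqnn andbT.
  by apply/subsetP=> w /[!inE] euw; rewrite sym; apply: full => //; rewrite sym.
have Ne x y z : N x = N y -> e x z = e y z by move/setP/(_ z); rewrite !inE.
have clos : closed e [pred x | e u x || e v x].
  apply: intro_closed; first exact: sym_connect_sym.
  move=> x y exy /[!inE] /orP[/Nu|/Nv] /Ne <-; by rewrite exy ?orbT.
have cover x : e u x || e v x.
  by have := closed_connect clos (con u x); rewrite !inE (sym v u) euv orbT => <-.
(* A common neighbour would give [N u = N v], making [v] adjacent to itself. *)
have disj x : e v x = ~~ e u x.
  have := cover x; case ux: (e u x); case vx: (e v x) => //= _.
  by have := Nv _ vx; rewrite (Nu _ ux) => /(Ne _ _ v); rewrite irr euv.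
have eE x y : e x y = (e u x != e u y).
  case ux: (e u x); first by rewrite (Ne _ _ y (Nu _ ux)) disj; case: (e u y).
  by rewrite (Ne _ _ y (Nv x _)) ?disj ?ux //; case: (e u y).
have nE : n = d.*2.
  rewrite -[LHS](card_ord n) -(cardsC (N u)) -addnn cN -{3}(cN v); congr (_ + _)%N.
  by apply: eq_card => x; rewrite !inE disj.
split; first by rewrite nE odd_double.
have [f bf fE] := exists_bij_initial (N u).
exists f; split=> // x y; rewrite /Kbal.
have -> : n./2 = #|N u| by rewrite cN nE doubleK.
by rewrite !fE !inE eE.
Qed.

(** * Traces and positivity of the signless Laplacian *)

Lemma natr_deg (R : pzSemiRingType) (n : nat) (e : rel 'I_n) (v : 'I_n) :
  (deg e v)%:R = \sum_(w < n) (e v w)%:R :> R.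
Proof.
rewrite /deg -sum1_card natr_sum big_mkcond; apply: eq_bigr => w _.
by rewrite inE; case: (e v w).
Qed.

Lemma mul_row_signless_laplacian (R : nzRingType) (n : nat) (e : rel 'I_n) (x : 'rV[R]_n)
    (j : 'I_n) :
  (x *m signless_laplacian R e) 0 j =
    x 0 j * (deg e j)%:R + \sum_(i < n) x 0 i * (e i j)%:R.
Proof.
rewrite mxE (eq_bigr (fun i => x 0 i * ((i == j) * deg e i)%:R + x 0 i * (e i j)%:R)).
  rewrite big_split /= (bigD1 j) //= eqxx mul1n big1 ?addr0 // => i /negbTE->.
  by rewrite mul0n mulr0.
by move=> i _; rewrite mxE natrD mulrDr.
Qed.

Lemma tr_signless_laplacian (R : nzRingType) (n : nat) (e : rel 'I_n) :
  symmetric e -> (signless_laplacian R e)^T = signless_laplacian R e.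
Proof.
move=> sym; apply/matrixP=> i j; rewrite !mxE sym eq_sym.
by case: eqP => // ->.
Qed.

Lemma mxtrace_signless_laplacian (R : nzRingType) (n : nat) (e : rel 'I_n) :
  simple_graph e -> \tr (signless_laplacian R e) = (2 * nedges e)%:R.
Proof.
move=> Ge; rewrite -(sum_deg Ge) natr_sum; apply: eq_bigr => i _.
by rewrite mxE eqxx mul1n Ge.2 addn0.
Qed.

(** The diagonal entry of [Q ^+ 2] at [i] is the squared degree, plus 1 for each neighbour of
    [i]. *)
Lemma mxtrace_sqr_signless_laplacian (R : nzRingType) (n : nat) (e : rel 'I_n) :
  simple_graph e ->
  \tr (signless_laplacian R e *m signless_laplacian R e) =
    (2 * nedges e + zagreb1 e)%:R.
Proof.
move=> Ge; have [sym irr] := Ge.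
rewrite -(sum_deg Ge) /zagreb1 -big_split natr_sum; apply: eq_bigr => i _ /=.
rewrite mxE (bigD1 i) //= !mxE eqxx irr mul1n addn0 addnC natrD natrX expr2.
congr (_ + _); rewrite natr_deg [RHS](bigD1 i) //= irr add0r.
apply: eq_bigr => j nji; rewrite !mxE (eq_sym i j) (negbTE nji) (sym j) !add0n.
by case: (e i j); rewrite ?mulr1 ?mulr0.
Qed.

(** Source of positive semidefiniteness. The factor 2 appears because the double sum meets every
    edge in both orders. *)
Lemma signless_laplacian_quadratic_form (R : comNzRingType) (n : nat) (e : rel 'I_n)
    (x : 'rV[R]_n) :
  symmetric e ->
  2%:R * (x *m signless_laplacian R e *m x^T) 0 0 =
    \sum_(i < n) \sum_(j < n) (e i j)%:R * (x 0 i + x 0 j) ^+ 2.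
Proof.
move=> sym.
pose D := \sum_(i < n) x 0 i ^+ 2 * (deg e i)%:R.
pose C := \sum_(i < n) \sum_(j < n) x 0 i * x 0 j * (e i j)%:R.
have -> : (x *m signless_laplacian R e *m x^T) 0 0 = D + C.
  rewrite mxE /D /C -big_split; apply: eq_bigr => i _ /=.
  rewrite mul_row_signless_laplacian mxE mulrDl; congr (_ + _); first by ring.
  by rewrite mulr_suml; apply: eq_bigr => j _; rewrite (sym j); ring.
have DE : D = \sum_(i < n) \sum_(j < n) (e i j)%:R * x 0 i ^+ 2.
  by apply: eq_bigr => i _; rewrite natr_deg mulr_sumr; apply: eq_bigr => j _; ring.
have DE' : D = \sum_(i < n) \sum_(j < n) (e i j)%:R * x 0 j ^+ 2.
  rewrite DE exchange_big; apply: eq_bigr => i _; apply: eq_bigr => j _.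
  by rewrite (sym j).
transitivity (D + 2%:R * C + D); first by ring.
rewrite {1}DE DE' mulr_sumr -!big_split; apply: eq_bigr => i _ /=.
rewrite mulr_sumr -!big_split; apply: eq_bigr => j _ /=; ring.
Qed.

Lemma signless_laplacian_eigenvalue_ge0 (R : realFieldType) (n : nat) (e : rel 'I_n) (q : R) :
  symmetric e -> eigenvalue (signless_laplacian R e) q -> 0 <= q.
Proof.
move=> sym /eigenvalueP[x xQ x0].
have := signless_laplacian_quadratic_form x sym.
rewrite xQ -scalemxAl mxE => E.
have xx0 : 0 < (x *m x^T) 0 0.
  by rewrite lt_def dot_ge0 andbT; apply: contraNneq x0 => /dot_eq0->.
rewrite -(pmulr_lge0 _ xx0) -(pmulr_rge0 _ (ltr0n R 2)) E.
by apply: sumr_ge0 => i _; apply: sumr_ge0 => j _; rewrite mulr_ge0 ?sqr_ge0 ?ler0n.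
Qed.

Lemma spectrum_eigenvalue (F : fieldType) (n : nat) (A : 'M[F]_n) (s : seq F) (q : F) :
  char_poly A = \prod_(q <- s) ('X - q%:P) -> q \in s -> eigenvalue A q.
Proof. by move=> sA qs; rewrite eigenvalue_root_char sA root_prod_XsubC. Qed.

Lemma sumr_const_seq (V : nmodType) (T : Type) (s : seq T) (c : V) :
  \sum_(x <- s) c = c *+ size s.
Proof. by rewrite big_const_seq count_predT iter_addr_0. Qed.

Lemma avg_degM (R : numFieldType) (n : nat) (e : rel 'I_n) :
  (0 < n)%N -> avg_deg R e * n%:R = (2 * nedges e)%:R.
Proof. by move=> n0; rewrite /avg_deg divfK // pnatr_eq0 -lt0n. Qed.

Lemma sum_sub_avg_deg (R : numFieldType) (n : nat) (e : rel 'I_n) (s : seq R) :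
  (0 < n)%N -> simple_graph e -> is_Q_spectrum e s ->
  \sum_(q <- s) (q - avg_deg R e) = 0.
Proof.
move=> n0 Ge sQ; rewrite sumrB -(mxtrace_spectrum sQ) mxtrace_signless_laplacian //.
by rewrite sumr_const_seq (size_spectrum sQ) -[_ *+ n]mulr_natr avg_degM // subrr.
Qed.

Lemma sum_sqr_sub_avg_deg (R : numFieldType) (n : nat) (e : rel 'I_n) (s : seq R) :
  (0 < n)%N -> simple_graph e -> is_Q_spectrum e s ->
  \sum_(q <- s) (q - avg_deg R e) ^+ 2 =
    (2 * nedges e + zagreb1 e)%:R - 4%:R * (nedges e)%:R ^+ 2 / n%:R.
Proof.
move=> n0 Ge sQ; set a := avg_deg R e.
have nR : n%:R != 0 :> R by rewrite pnatr_eq0 -lt0n.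
rewrite (eq_bigr (fun q => q ^+ 2 - (2%:R * a * q - a ^+ 2))) => [|q _]; last by ring.
rewrite !sumrB -mulr_sumr -(mxtrace_spectrum sQ) mxtrace_signless_laplacian //.
rewrite -(mxtrace_sqr_spectrum sQ) mxtrace_sqr_signless_laplacian //.
rewrite sumr_const_seq (size_spectrum sQ) -[_ *+ n]mulr_natr; congr (_ - _).
rewrite /a /avg_deg natrM; field.
exact: nR.
Qed.

(** In this form the quantity is visibly positive once the graph has an edge. *)
Lemma sum_sqr_sub_avg_deg_degrees (R : numFieldType) (n : nat) (e : rel 'I_n) :
  (0 < n)%N -> simple_graph e ->
  (2 * nedges e + zagreb1 e)%:R - 4%:R * (nedges e)%:R ^+ 2 / n%:R =
  (2 * nedges e)%:R + \sum_(v < n) ((deg e v)%:R - avg_deg R e) ^+ 2.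
Proof.
move=> n0 Ge; set a := avg_deg R e.
have nR : n%:R != 0 :> R by rewrite pnatr_eq0 -lt0n.
rewrite (eq_bigr (fun v => ((deg e v) ^ 2)%:R - (2%:R * a * (deg e v)%:R - a ^+ 2)))
  => [|v _]; last by ring.
rewrite !sumrB -mulr_sumr -!natr_sum sum_deg // sumr_const card_ord -[_ *+ n]mulr_natr.
rewrite natrD /zagreb1 -[in LHS]addrA; congr (_ + (_ - _)).
rewrite /a /avg_deg natrM; field.
exact: nR.
Qed.

Lemma connected_has_edge (n : nat) (e : rel 'I_n) :
  (2 <= n)%N -> connected_graph e -> exists u v, e u v.
Proof.
case: n e => [|[|n]] // e _ /(_ ord0 ord_max) /connectP[[|v p] /= pth E].
  by move/(congr1 val): E.
by case/andP: pth => ? _; exists ord0, v.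
Qed.

Lemma nedges_gt0 (n : nat) (e : rel 'I_n) (u v : 'I_n) :
  simple_graph e -> e u v -> (0 < nedges e)%N.
Proof.
move=> Ge euv; suff : (0 < 2 * nedges e)%N by rewrite muln_gt0.
rewrite -(sum_deg Ge) (bigD1 u) //= addn_gt0; apply/orP; left.
by rewrite card_gt0; apply/set0Pn; exists v; rewrite inE.
Qed.

(** * Sums of squares against the maximum *)

(** The gap is the sum of the nonnegative terms [F x * (M - F x)], so it vanishes only if every term
    does. *)
Lemma sum_sqr_le_bound (R : realDomainType) (T : eqType) (t : seq T) (F : T -> R) (M : R) :
  {in t, forall x, 0 <= F x <= M} ->
  \sum_(x <- t) F x ^+ 2 <= (\sum_(x <- t) F x) * M ?= iff
    all (fun x => (F x == 0) || (F x == M)) t.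
Proof.
move=> FM.
have dE : (\sum_(x <- t) F x) * M - \sum_(x <- t) F x ^+ 2 =
    \sum_(x <- t | x \in t) F x * (M - F x).
  by rewrite -big_seq mulr_suml -sumrB; apply: eq_bigr => x _; ring.
have ge0 x : x \in t -> 0 <= F x * (M - F x).
  by case/FM/andP=> F0 FM'; rewrite mulr_ge0 ?subr_ge0.
split; first by rewrite -subr_ge0 dE sumr_ge0.
rewrite eq_sym -subr_eq0 dE psumr_eq0 //.
apply: eq_in_all => x xt; rewrite xt mulf_eq0 subr_eq0 /=.
by rewrite [M == _]eq_sym.
Qed.

(** Positivity excludes the default value 0, which no element need attain. *)
Lemma bigmax0_attained (R : realDomainType) (T : eqType) (t : seq T) (F : T -> R) :
  0 < \big[Num.max/0]_(x <- t) F x ->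
  exists2 x, x \in t & F x = \big[Num.max/0]_(x <- t) F x.
Proof.
elim: t => [|x t IH]; first by rewrite big_nil ltxx.
rewrite big_cons; case: (leP (F x) (\big[Num.max/0]_(x <- t) F x)) => _ h.
  by have [y yt Ey] := IH h; exists y; rewrite // inE yt orbT.
by exists x; rewrite ?mem_head.
Qed.

(** * Structure and spectrum of the balanced complete bipartite graph *)

Lemma card_ord_ltn (n k : nat) : (k <= n)%N -> #|[set i : 'I_n | (i < k)%N]| = k.
Proof.
by move=> kn; rewrite -sum1dep_card (big_ord_narrow kn) sum_nat_const card_ord muln1.
Qed.

Lemma is_K_half_half_sides (n : nat) (e : rel 'I_n) :
  is_K_half_half e ->
  exists2 side : pred 'I_n, (forall b, #|[set x | side x == b]| = n./2) &
    forall x y, e x y = (side y == ~~ side x).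
Proof.
move=> [evn [f [bf fE]]].
have cT : #|[set x | (f x < n./2)%N == true]| = n./2.
  rewrite -[RHS](@card_ord_ltn n); last by rewrite -[leqRHS]odd_double_half -addnn addnCA leq_addr.
  rewrite -[RHS](card_preimset _ (bij_inj bf)).
    by apply: eq_card => x; rewrite !inE; case: (f x < _)%N.
exists (fun x => (f x < n./2)%N) => [[] //|x y]; last first.
  by rewrite fE /Kbal; do 2!case: (_ < _)%N.
apply/eqP; rewrite -(eqn_add2l n./2) -{1}cT addnn even_halfK //.
rewrite -[X in _ == X]card_ord -(cardsC [set x | (f x < n./2)%N == true]); apply/eqP.
by congr (_ + _)%N; apply: eq_card => x; rewrite !inE; case: (f x < _)%N.
Qed.

Lemma is_K_half_half_deg (n : nat) (e : rel 'I_n) (v : 'I_n) :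
  is_K_half_half e -> deg e v = n./2.
Proof.
case/is_K_half_half_sides=> side cS eE.
by rewrite -(cS (~~ side v)); apply: eq_card => w; rewrite !inE eE.
Qed.

Lemma avg_deg_regular (R : numFieldType) (n : nat) (e : rel 'I_n) (d : nat) :
  (0 < n)%N -> simple_graph e -> (forall v, deg e v = d) -> avg_deg R e = d%:R.
Proof.
move=> n0 Ge reg; have nR : n%:R != 0 :> R by rewrite pnatr_eq0 -lt0n.
apply: (mulIf nR); rewrite avg_degM // -(sum_deg Ge) (eq_bigr (fun=> d)) //.
by rewrite sum_nat_const card_ord mulnC natrM.
Qed.

(* With [b = q - n/2], the eigenvalue equation makes [b] exchange the sums of the coordinates
   over the two sides, up to the factor [n/2]. *)
Lemma is_K_half_half_eigenvalue (R : realFieldType) (n : nat) (e : rel 'I_n) (q : R) :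
  is_K_half_half e -> eigenvalue (signless_laplacian R e) q ->
  (`|q - n./2%:R| == 0) || (`|q - n./2%:R| == n./2%:R).
Proof.
move=> K /eigenvalueP[x xQ /rV0Pn[j0 xj0]].
have [side cS eE] := is_K_half_half_sides K.
set d : R := n./2%:R; set b := q - d.
pose S t := \sum_(j < n | side j == t) x 0 j.
have bx j : b * x 0 j = S (~~ side j).
  have := congr1 (fun y : 'rV_n => y 0 j) xQ.
  rewrite mul_row_signless_laplacian (is_K_half_half_deg j K) mxE -/d => E.
  rewrite /b mulrBl -E addrC mulrC addKr /S [RHS]big_mkcond; apply: eq_bigr => i _.
  rewrite eE; case: (side i); case: (side j); by rewrite ?mulr1 ?mulr0.
have bS t : b * S t = d * S (~~ t).
  rewrite /S mulr_sumr (eq_bigr (fun=> S (~~ t))) => [|j /eqP<-]; last exact: bx.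
  rewrite (eq_bigl [in [set j | side j == t]]) => [|j]; last by rewrite inE.
  by rewrite sumr_const cS -[_ *+ n./2]mulr_natl.
rewrite normr_eq0; have [//|b0 /=] := eqVneq b 0.
(* A nonzero sum over one side, on which two applications of [bS] act as both [b ^+ 2] and
   [d ^+ 2]. *)
have St : S (~~ side j0) != 0 by rewrite -bx mulf_neq0.
have : b ^+ 2 = d ^+ 2.
  by apply: (mulIf St); rewrite !expr2 -!mulrA bS mulrCA bS negbK.
move/eqP; rewrite -(real_normK (num_real b)) eqf_sqr => /orP[//|/eqP E].
have d0 : 0 <= d by exact: ler0n.
by have := normr_ge0 b; rewrite E => ?; apply/eqP; lra.
Qed.

(** * From three eigenvalues to the complete bipartite graph *)

Lemma signless_laplacian_const1 (R : nzRingType) (n : nat) (e : rel 'I_n) (j : 'I_n) :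
  symmetric e -> (const_mx 1 *m signless_laplacian R e : 'rV[R]_n) 0 j = (2 * deg e j)%:R.
Proof.
move=> sym; rewrite mul_row_signless_laplacian mxE mul1r mul2n -addnn natrD.
by congr (_ + _); rewrite natr_deg; apply: eq_bigr => i _; rewrite mxE mul1r sym.
Qed.

(* Testing [|B x| <= g |x|] on the all-ones vector gives [a <= g], with equality only for
   regular graphs; positive semidefiniteness of [Q] gives [g <= a]. *)
Lemma three_eigenvalues_regular (R : realFieldType) (n : nat) (e : rel 'I_n) (s : seq R) (g : R) :
  (0 < n)%N -> simple_graph e -> is_Q_spectrum e s -> 0 < g ->
  avg_deg R e - g \in s ->
  {in s, forall q, (`|q - avg_deg R e| == 0) || (`|q - avg_deg R e| == g)} ->
  let B := signless_laplacian R e - (avg_deg R e)%:M in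
  [/\ B *m B *m B = g ^+ 2 *: B, g = avg_deg R e & forall v, (deg e v)%:R = avg_deg R e].
Proof.
case: n e => // n e _ Ge sQ g0 gs sg; set a := avg_deg R e; move=> B.
have [sym irr] := Ge.
have symB : B^T = B by rewrite linearB /= tr_signless_laplacian // tr_scalar_mx.
have B3 : B *m B *m B = g ^+ 2 *: B.
  have rp : {in s, forall q, root (('X - a%:P) ^+ 3 - (g ^+ 2) *: ('X - a%:P)) q}.
    move=> q /sg; rewrite /root !hornerE -/a => h; apply/eqP.
    have [h0|hg] : q - a = 0 \/ (q - a) ^+ 2 = g ^+ 2.
      case/orP: h => [|/eqP h]; first by rewrite normr_eq0 => /eqP; left.
      by right; rewrite -h real_normK ?num_real.
    - by rewrite h0; ring.
    - by rewrite exprS hg; ring.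
  have := spectrum_annihilator (tr_signless_laplacian R sym) sQ rp.
  rewrite rmorphB rmorphXn /= linearZ /= rmorphB /= horner_mx_X horner_mx_C -/B.
  by move/eqP; rewrite subr_eq0 => /eqP <-; rewrite -mulmxA.
have ga : g <= a.
  by rewrite -subr_ge0 (signless_laplacian_eigenvalue_ge0 sym (spectrum_eigenvalue sQ gs)).
pose x : 'rV[R]_n.+1 := const_mx 1.
have := symmetric_norm_bound x symB g0 B3.
set W := \sum_(v < n.+1) ((deg e v)%:R - a) ^+ 2.
have sum0 : \sum_(v < n.+1) ((deg e v)%:R - a) = 0.
  by rewrite sumrB -natr_sum sum_deg // sumr_const card_ord -[_ *+ n.+1]mulr_natr avg_degM // subrr.
have entry v : (x *m B) 0 v = 2%:R * ((deg e v)%:R - a) + a.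
  rewrite mulmxBr mul_mx_scalar [LHS]mxE signless_laplacian_const1 // !mxE natrM; ring.
(* The cross terms vanish because the deviations [deg e v - a] sum to zero. *)
have -> : (x *m B *m (x *m B)^T) 0 0 = 4%:R * W + a ^+ 2 * n.+1%:R.
  transitivity (\sum_(v < n.+1) (4%:R * ((deg e v)%:R - a) ^+ 2
      + (4%:R * a * ((deg e v)%:R - a) + a ^+ 2))).
    by rewrite mxE; apply: eq_bigr => v _; rewrite [_^T _ _]mxE entry; ring.
  by rewrite !big_split /= sumr_const card_ord -!mulr_sumr sum0 mulr0 add0r -[_ *+ n.+1]mulr_natr.
have -> : (x *m x^T) 0 0 = n.+1%:R :> R.
  rewrite mxE (eq_bigr (fun=> 1)) ?sumr_const ?card_ord // => v _.
  by rewrite !mxE mulr1.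
(* [bnd] now says [4 W + a^2 n <= g^2 n]: it yields [a <= g], and then [W = 0] once [g = a]. *)
move=> bnd; have W0 : 0 <= W by apply: sumr_ge0 => v _; exact: sqr_ge0.
have n0 : 0 < n.+1%:R :> R by rewrite ltr0n.
have ag : a <= g.
  by rewrite -(ler_pXn2r (n := 2)) ?nnegrE //; [rewrite -(ler_pM2r n0); lra|lra|lra].
have Ega : g = a by apply/le_anti/andP.
have {}W0 : W = 0 by move: bnd; rewrite Ega; lra.
split=> // v; apply/eqP; rewrite -subr_eq0 -sqrf_eq0; apply/eqP.
by apply: (psumr_eq0P _ W0 (i := v)) => // i _; exact: sqr_ge0.
Qed.

(* Counting walks of length 3: [A^3 = d^2 A] forces all [d^2] pairs of neighbours of
   the ends of an edge to be adjacent. *)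
Lemma complete_nbhd_of_adjacency_cube (R : realFieldType) (n : nat) (e : rel 'I_n) (d : nat)
    (u v : 'I_n) :
  symmetric e -> (forall x, deg e x = d) -> e u v ->
  \sum_(z < n) (\sum_(w < n) (e u w)%:R * (e w z)%:R) * (e z v)%:R = d%:R ^+ 2 :> R ->
  forall w z, e u w -> e z v -> e w z.
Proof.
move=> sym reg euv cube w z euw ezv.
(* [F z w] marks the neighbour pairs that fail to be adjacent; their number is [d * d] minus the
   number of walks, hence 0. *)
pose F z w : R := (e u w)%:R * (1 - (e w z)%:R) * (e z v)%:R.
have F0 z' w' : 0 <= F z' w'.
  by rewrite /F !mulr_ge0 ?ler0n // subr_ge0; case: (e w' z'); rewrite ?lexx ?ler01.
have sF : \sum_(z < n) \sum_(w < n) F z w = 0.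
  transitivity (\sum_(z < n) (d%:R * (e z v)%:R
      - (\sum_(w < n) (e u w)%:R * (e w z)%:R) * (e z v)%:R) : R).
    apply: eq_bigr => z' _; rewrite -(reg u) natr_deg !mulr_suml -sumrB.
    by apply: eq_bigr => w' _; rewrite /F; ring.
  rewrite sumrB cube -mulr_sumr (eq_bigr (fun z => (e v z)%:R)) => [|z' _]; last by rewrite sym.
  by rewrite -natr_deg reg expr2 subrr.
have sFz := psumr_eq0P (fun z _ => sumr_ge0 _ (fun w _ => F0 z w)) sF (i := z) isT.
have := psumr_eq0P (fun w _ => F0 z w) sFz (i := w) isT.
by rewrite /F euw ezv mul1r mulr1; case: (e w z) => // /eqP; rewrite subr0 oner_eq0.
Qed.

Lemma is_K_half_half_of_three_eigenvalues (R : realFieldType) (n : nat) (e : rel 'I_n) (s : seq R)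
    (g : R) :
  (2 <= n)%N -> simple_graph e -> connected_graph e -> is_Q_spectrum e s -> 0 < g ->
  avg_deg R e - g \in s ->
  {in s, forall q, (`|q - avg_deg R e| == 0) || (`|q - avg_deg R e| == g)} ->
  is_K_half_half e.
Proof.
move=> n2 Ge con sQ g0 gs sg.
have [u [v euv]] := connected_has_edge n2 con.
have [B3 Eg regR] := three_eigenvalues_regular (ltnW n2) Ge sQ g0 gs sg.
have reg x : deg e x = deg e u by apply/eqP; rewrite -(eqr_nat R) !regR.
(* Regularity cancels the diagonal, leaving the adjacency matrix. *)
have BE : signless_laplacian R e - (avg_deg R e)%:M = \matrix_(i, j) (e i j)%:R.
  apply/matrixP=> i j; rewrite !mxE -(regR i) natrD natrM.
  by case: (i == j); rewrite ?mulr1n ?mulr0n; ring.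
have [sym irr] := Ge.
apply: (is_K_half_half_of_complete_nbhd Ge con reg euv).
apply: (complete_nbhd_of_adjacency_cube (R := R) sym reg euv).
move/matrixP/(_ u v): B3; rewrite BE !mxE euv mulr1 Eg -(regR u) => <-.
apply: eq_bigr => z _; rewrite !mxE; congr (_ * _).
by apply: eq_bigr => w _; rewrite !mxE.
Qed.

(** * The bound and the two directions of its equality case *)

Theorem mainTheorem10 (R : rcfType) (n : nat) (e : rel 'I_n) (s : seq R) :
  (2 <= n)%N -> simple_graph e -> connected_graph e ->
  is_Q_spectrum e s ->
  avg_deg R e \in s ->
  QE e s >= ((2 * nedges e + zagreb1 e)%:R - 4%:R * (nedges e)%:R ^+ 2 / n%:R)
              / gamma1 e s
  /\ (QE e s = ((2 * nedges e + zagreb1 e)%:R - 4%:R * (nedges e)%:R ^+ 2 / n%:R)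
              / gamma1 e s <-> is_K_half_half e).
Proof.
move=> n2 Ge con sQ _; have n0 := ltnW n2.
set S2 := _ - _; set a := avg_deg R e.
have S2E : \sum_(q <- s) `|q - a| ^+ 2 = S2.
  rewrite /S2 -(sum_sqr_sub_avg_deg n0 Ge sQ).
  by apply: eq_bigr => q _; rewrite real_normK ?num_real.
have S2_gt0 : 0 < S2.
  have [u [v euv]] := connected_has_edge n2 con.
  rewrite /S2 sum_sqr_sub_avg_deg_degrees // ltr_wpDr //.
    by apply: sumr_ge0 => w _; exact: sqr_ge0.
  by rewrite ltr0n muln_gt0 (nedges_gt0 Ge euv).
have range : {in s, forall q, 0 <= `|q - a| <= gamma1 e s}.
  by move=> q qs; rewrite normr_ge0; exact: (le_bigmax_seq 0 q xpredT (fun q => `|q - a|) qs).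
have bound := sum_sqr_le_bound range; rewrite S2E -/(QE e s) in bound.
(* Otherwise the bound would give [S2 <= 0]. *)
have g0 : 0 < gamma1 e s.
  rewrite lt_def [0 <= _]bigmax_ge_id andbT; apply: contraTneq S2_gt0 => g0.
  by rewrite -leNgt; have := bound.1; rewrite g0 mulr0.
split; first by rewrite ler_pdivrMr // bound.1.
have -> : QE e s = S2 / gamma1 e s <->
    all (fun q => (`|q - a| == 0) || (`|q - a| == gamma1 e s)) s.
  rewrite -bound.2 eq_sym; split=> [->|/eqP<-]; first by rewrite divfK ?eqxx ?gt_eqF.
  by rewrite mulfK ?gt_eqF.
split=> [/allP sg|K].
  apply: (is_K_half_half_of_three_eigenvalues n2 Ge con sQ g0 _ sg).
  (* The deviations sum to zero without all vanishing, so one is negative; having absolute value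
     [gamma1 e s], it comes from the eigenvalue [a - gamma1 e s]. *)
  have [/allP ge0|/allPn[q qs]] := boolP (all (fun q => 0 <= q - a) s).
    have s0 := sum_sub_avg_deg n0 Ge sQ; move: S2_gt0; rewrite -S2E => /lt0r_neq0/eqP[].
    rewrite big_seq big1 // => q qs; apply/eqP; rewrite sqrf_eq0 normr_eq0.
    move/eqP: s0; rewrite big_seq psumr_eq0 // => /allP/(_ q qs).
    by rewrite qs.
  rewrite -ltNge => neg; move: (sg q qs); rewrite normr_eq0 lt_eqF //= ltr0_norm // => /eqP<-.
  by rewrite opprK addrC subrK.
have aE : a = n./2%:R.
  by apply: avg_deg_regular => // v; exact: is_K_half_half_deg.
have vals q : q \in s -> (`|q - a| == 0) || (`|q - a| == n./2%:R).
  by move=> qs; rewrite aE (is_K_half_half_eigenvalue K (spectrum_eigenvalue sQ qs)).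
(* The positive maximum is itself one of the values 0 and [n./2], so [gamma1 e s] is [n./2]. *)
have [q qs qE] := bigmax0_attained g0.
have := vals q qs; rewrite qE -/(gamma1 e s) gt_eqF //= => /eqP->.
by apply/allP.
Qed.
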